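(* Let $\omega=\omega(n)$ be a function tending to infinity arbitrarily slowly, and suppose $k=k(n)$ satisfies $c(Q_n)\le k\le 2^n/\omega$. Then $\mathrm{capt}_k(Q_n)\le (1+o(1))\log_2(2^n/k)\log\log(2^n/k)$. In particular, if $k=b^n$ for some constant $1<b<2$, then $\mathrm{capt}_k(Q_n)\le (1+o(1))(1-\log_2 b)\,n\log n$.
   Context: $Q_n$ is the $n$-dimensional hypercube on $2^n$ vertices, viewed as a reflexive graph; its cop number is $c(Q_n)=\lceil (n+1)/2\rceil$. The game of Cops and Robbers: cops choose starting vertices (round 0), then the robber; players alternate, cops (any subset) moving to adjacent vertices or staying put, then the robber moving or staying; cops win by occupying the robber's vertex. For $k\ge c(G)$, $\mathrm{capt}_k(G)$ is the minimum over $k$-cop strategies of the number of rounds (excluding round 0) until capture against an optimally evading robber. Asymptotic notation is as $n\to\infty$; $\log$ denotes the natural logarithm. *)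

(* Defs.v *)
From HB Require Import structures.
From mathcomp Require Import all_boot all_order all_algebra.
From mathcomp Require Import all_classical all_reals all_analysis.

Set Implicit Arguments.
Unset Strict Implicit.
Unset Printing Implicit Defensive.

Import Order.TTheory GRing.Theory Num.Theory.
Import numFieldNormedType.Exports.

Local Open Scope classical_set_scope.
Local Open Scope ring_scope.

(* Finite reflexive graphs: the loops are what allows a player to stay put. *)
Record rgraph := RGraph {
  vertex :> finType;
  adj : rel vertex;
  adj_refl : reflexive adj;
  adj_sym : symmetric adj }.

Section Hypercube.
Variable n : nat.

Definition cube_adj (u v : {ffun 'I_n -> bool}) : bool :=
  (#|[pred i | u i != v i]| <= 1)%N.

Lemma cube_adj_refl : reflexive cube_adj.
Proof.
by move=> u; rewrite /cube_adj eq_card0 // => i; rewrite !inE eqxx.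
Qed.

Lemma cube_adj_sym : symmetric cube_adj.
Proof.
move=> u v; rewrite /cube_adj; congr (_ <= 1)%N.
by apply: eq_card => i; rewrite !inE eq_sym.
Qed.

Definition hypercube : rgraph := RGraph cube_adj_refl cube_adj_sym.
End Hypercube.

Section Game.
Variables (G : rgraph) (k : nat).

(* A strategy maps the robber's past positions [:: r_0; ...; r_(t-1)] to the
   positions of the k cops after their move in round t; the empty history
   gives their starting vertices. *)
Definition strategy := seq G -> 'I_k -> G.

Definition legal (sigma : strategy) : Prop :=
  forall (h : seq G) (r : G) (i : 'I_k), adj (sigma h i) (sigma (rcons h r) i).

(* r t is the robber's position at the end of round t. *)
Definition robber_walk (r : nat -> G) : Prop :=
  forall t, adj (r t) (r t.+1).

(* Capture in round t: a cop is on the robber's vertex either at the end of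
   the round, or, for t > 0, between the cops' and the robber's move, while the
   robber is still at r t.-1. *)
Definition captured_in (sigma : strategy) (r : nat -> G) (t : nat) : Prop :=
  exists i, sigma (mkseq r t) i = r t
            \/ ((0 < t)%N /\ sigma (mkseq r t) i = r t.-1).

Definition cops_win : Prop :=
  exists sigma, legal sigma /\
    forall r, robber_walk r -> exists t, captured_in sigma r t.

Definition cops_win_within (t : nat) : Prop :=
  exists sigma, legal sigma /\
    forall r, robber_walk r -> exists s, (s <= t)%N /\ captured_in sigma r s.

(* The least t for which k cops can guarantee capture within t rounds; it is
   +oo when there is none. *)
Definition capt (R : realType) : \bar R :=
  ereal_inf [set t%:R%:E | t in cops_win_within].

End Game.

Lemma exists_cops_win (G : rgraph) : exists k, `[< cops_win G k >].
Proof.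
exists #|G|; apply/asboolP; exists (fun _ i => enum_val i); split.
  by move=> h r i; exact: adj_refl.
move=> r _; exists 0%N, (enum_rank (r 0%N)); left; exact: enum_rankK.
Qed.

Definition cop_number (G : rgraph) : nat := ex_minn (exists_cops_win G).

Definition log2 (R : realType) (x : R) : R := ln x / ln 2.

(* Main.v *)
Require Import Defs.
From HB Require Import structures.
From mathcomp Require Import all_boot all_order all_algebra.
From mathcomp Require Import all_classical all_reals all_analysis.
From mathcomp Require Import zify ring lra.
Import Order.TTheory GRing.Theory Num.Theory.
Import numFieldNormedType.Exports.
Local Open Scope classical_set_scope.
Local Open Scope ring_scope.

(* Record each cop by the set of coordinates in which it differs from the
   robber: the robber toggles one coordinate i in all these sets, after which
   each cop may toggle one coordinate in its own. Let the load of j be the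
   number of sets containing j, and fix a level H. A coordinate of load above H
   lies in more than H sets, so greedily H distinct cops can each drop one unit
   of the total excess of the loads over H; those of them whose set did not
   contain i pick it up, which leaves the load of i at most H, and everyone else
   mirrors the robber. Hence loads go from at most H + 1 to at most H in about
   n / H rounds, and from k to 1 in about n (1 + 1/2 + ... + 1/k) ~ n log n.
   Once the sets are disjoint and n < 2 k, some set is a singleton, and the
   robber is forced to destroy one singleton per round.
   With more cops, take the least m with 2 ^ (n - m) (m/2 + 1) <= k and let a
   team play this strategy in each copy of Q_m against the projection of the
   robber. Such an m <= n exists because fewer than (n + 1) / 2 cops cannot
   dominate the closed neighbourhood of the robber. *)

Set Implicit Arguments.
Unset Strict Implicit.
Unset Printing Implicit Defensive.

(** * The game played on difference sets *)

Section DifferenceGame.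
Import fintype finset.
Local Open Scope nat_scope.
Local Open Scope set_scope.
Variables (I X : finType).
Implicit Types (D : I -> {set X}) (x : option X) (A : {set X}).

Definition toggle x A : {set X} := [set j | (x == Some j) (+) (j \in A)].

(* The game just after a move of the cops: [D c] is the set of coordinates in
   which cop [c] differs from the robber, and toggling [None] is staying put. *)
Fixpoint catch (t : nat) D : Prop :=
  (exists c, D c = finset.set0) \/
  if t is t'.+1 then
    forall x, exists f : I -> option X,
      catch t' (fun c => toggle (f c) (toggle x (D c)))
  else False.

Lemma catch_captured t D c : D c = finset.set0 -> catch t D.
Proof. by case: t => [|t] Dc; left; exists c. Qed.

Definition load D (j : X) := #|[set c | j \in D c]%SET|.

Definition excess H D := \sum_j (load D j - H).

Lemma le_excess H D D' : (forall j, load D j <= load D' j) ->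
  excess H D <= excess H D'.
Proof. by move=> le_load; apply: leq_sum => j _; apply: leq_sub2r. Qed.

Lemma excess_eq0 H D : excess H D = 0 -> forall j, load D j <= H.
Proof.
move=> /eqP; rewrite sum_nat_eq0 => /forallP e0 j.
by have := e0 j; rewrite subn_eq0.
Qed.

(* A coordinate with load above H lies in more than H difference sets, so while
   fewer than H cops have dropped something an idle cop can still drop it. *)
Lemma greedy_drop H D s : s <= H -> exists f : I -> option X,
  [/\ #|[set c | f c]%SET| <= s, forall c j, f c = Some j -> j \in D c
    & excess H (fun c => [set j in D c | f c != Some j]%SET) <= excess H D - s].
Proof.
elim: s => [_|s IHs ltsH].
  exists (fun=> None); split=> //.
    by rewrite leqn0 cards_eq0; apply/eqP/setP => c; rewrite !inE.
  rewrite subn0; apply: le_excess => j; apply: subset_leq_card.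
  by apply/subsetP=> c; rewrite !inE andbT.
have [f [fs fD]] := IHs (ltnW ltsH).
set Df := (fun c => _) => exf.
have [e0|] := eqVneq (excess H Df) 0.
  by exists f; split=> //; [exact: leq_trans fs _ | rewrite -/Df e0].
rewrite sum_nat_eq0 negb_forall => /existsP[j]; rewrite subn_eq0 -ltnNge => ltHj.
have [c]: exists c, (c \in [set c | j \in Df c]%SET) && (c \notin [set c | f c]%SET).
  apply/existsP; apply: contraLR ltHj; rewrite negb_exists -leqNgt => /forallP sub.
  apply: leq_trans (leq_trans fs (ltnW ltsH)); apply: subset_leq_card.
  by apply/subsetP => c jc; have := sub c; rewrite jc negbK.
rewrite !inE => /andP[/andP[jDc _]]; case fc: (f c) => // _.
pose f' c' := if c' == c then Some j else f c'.
exists f'; split.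
- apply: (@leq_trans #|c |: [set c | f c]|%SET);
    last by rewrite cardsU1; case: (_ \notin _) => /=; lia.
  by apply: subset_leq_card; apply/subsetP=> c'; rewrite !inE /f'; case: eqP.
- by move=> c' l; rewrite /f'; case: eqP => [-> [<-]|_ /fD].
suff : excess H (fun c0 => [set j0 in D c0 | f' c0 != Some j0]%SET) < excess H Df by lia.
rewrite /excess (bigD1 j) //= [leqRHS](bigD1 j) //=.
set Df' := fun c0 : I => _.
have le_load l : load Df' l <= load Df l.
  apply: subset_leq_card; apply/subsetP=> c'; rewrite !inE /f'.
  by have [->|//] := eqVneq c' c; rewrite fc /= => /andP[->].
have ltj : load Df' j < load Df j.
  apply: proper_card; apply/properP; split.
    apply/subsetP=> c'; rewrite !inE /f'.
    by have [->|//] := eqVneq c' c; rewrite fc /= => /andP[->].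
  by exists c; rewrite !inE ?fc ?jDc // /f' !eqxx andbF.
rewrite -addSn; apply: leq_add; first by rewrite -/(load _ _); lia.
by apply: leq_sum => l _; apply: leq_sub2r.
Qed.

Lemma excess_step H D x : exists f : I -> option X,
  excess H (fun c => toggle (f c) (toggle x (D c))) <= excess H D - H.
Proof.
case: x => [i|]; last first.
  have [f [_ fD exf]] := greedy_drop D (leqnn H).
  exists f; apply: leq_trans exf; apply: le_excess => j.
  apply: subset_leq_card; apply/subsetP => c; rewrite !inE /=.
  by have [/fD ->|] := eqVneq (f c) (Some j); rewrite ?andbT.
(* With [i] deleted everywhere, the greedy choice spends no cop on [i], whose new load is bounded
   separately. *)
pose D0 c := (D c :\ i)%SET.
have [f [fH fD exf]] := greedy_drop D0 (leqnn H).
(* An idle cop without [i] undoes the robber's toggle, and an idle cop with [i] lets it go. So [i]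
   survives only in sets of cops that drop another coordinate, at most [H] of them. *)
pose f' c := if (i \notin D c) && (f c == None) then Some i else f c.
exists f'; set D' := fun c => _.
have exD0 : excess H D0 <= excess H D.
  apply: le_excess => j; apply: subset_leq_card.
  by apply/subsetP=> c; rewrite !inE => /andP[].
apply: leq_trans (leq_trans exf (leq_sub2r H exD0)).
apply: leq_sum => j _; have [->|jNi] := eqVneq j i.
  suff : load D' i <= H by lia.
  apply: leq_trans fH; apply: subset_leq_card; apply/subsetP=> c.
  rewrite !inE /f' eqxx; have [iD|iD] := boolP (i \in D c).
    by have [/fD|] := eqVneq (f c) (Some i); rewrite ?inE ?eqxx.
  by case: (f c) => [l|] //=; rewrite eqxx.
apply: leq_sub2r; apply: subset_leq_card; apply/subsetP=> c.
have iNj : (Some i == Some j) = false by rewrite eq_sym; apply/negbTE.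
rewrite !inE /f' jNi iNj; case fc: (f c) => [l|].
  rewrite andbF /=; have [ls|] := eqVneq (Some l) (Some j); rewrite ?andbT //.
  by move: fc; rewrite ls => /fD; rewrite !inE jNi => /= ->.
by rewrite andbT; case: (i \in D c); rewrite /= ?iNj ?andbT.
Qed.

Lemma catch_descent H t :
  (forall D, (forall j, load D j <= H) -> catch t D) ->
  forall e D, excess H D <= e * H -> catch (e + t) D.
Proof.
move=> catchH; elim=> [|e IHe] D exD.
  by apply/catchH/excess_eq0/eqP; rewrite -leqn0.
right=> x; have [f exf] := excess_step H D x.
by exists f; apply: IHe; rewrite mulSn in exD; lia.
Qed.

(* Each coordinate has load at most [H + 1], so the excess over [H] is at most
   [#|X|] and drops by [H] in every round. *)
Lemma catch_level t : (forall D, (forall j, load D j <= 1) -> catch t D) ->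
  forall H D, (forall j, load D j <= H.+1) ->
  catch (\sum_(1 <= h < H.+1) (#|X| %/ h).+1 + t) D.
Proof.
move=> catch1; elim=> [|H IHH] D leD; first by rewrite big_geq //; exact: catch1.
rewrite big_nat_recr //= addnAC addnC; apply: catch_descent IHH _ _ _.
apply: (@leq_trans (\sum_(j : X) 1)).
  by apply: leq_sum => j _; have := leD j; lia.
by rewrite sum1_card; apply/ltnW/ltn_ceil.
Qed.

(** Induction on the bound [s] for the number of singletons. A robber who stays put is caught by a
    singleton; one who toggles an element of a set of size at most 2 is caught by its owner.
    Otherwise a singleton absorbs the toggled coordinate and becomes a pair. A set losing that
    coordinate had at least 3 elements, so no singleton is created. *)
Lemma catch_disjoint s D : #|X| < 2 * #|I| -> (forall j, load D j <= 1) ->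
  #|[set c | #|D c| == 1]%SET| <= s -> catch s D.
Proof.
move=> ltXI; elim: s D => [|s IHs] D le1 les.
all: have [[c Dc]|Dn0] := pselect (exists c, D c = finset.set0);
  first exact: (catch_captured _ Dc).
(* Were all sets of size at least 2, their sizes would add up to at least [2 * #|I|], yet
   disjointness caps the sum at [#|X|]. *)
all: have [c1 c1s] : exists c, #|D c| == 1.
  1,3: apply/existsP; apply: contraLR ltXI; rewrite negb_exists -leqNgt => /forallP nsing.
  1,2: apply: (@leq_trans (\sum_c #|D c|)).
  1,3: rewrite mulnC -sum_nat_const; apply: leq_sum => c _.
  1,2: have : D c != finset.set0 by apply/eqP=> D0; apply: Dn0; exists c.
  1,2: by rewrite -card_gt0; have := nsing c; lia.
  1,2: under eq_bigr do rewrite -sum1_card big_mkcond.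
  1,2: rewrite exchange_big -sum1_card /=; apply: leq_sum => j _.
  1,2: by rewrite -big_mkcond sum1_card -(cardsE (fun c => j \in D c)); exact: le1.
  by move: les; rewrite leqn0 cards_eq0 => /eqP/setP/(_ c1); rewrite !inE c1s.
right=> x; have /cards1P[a Da] := c1s.
case: x => [i|]; last first.
  exists (fun=> Some a); apply: (@catch_captured _ _ c1).
  apply/setP=> j; rewrite !inE Da inE /= -[Some a == Some j]/(a == j) (eq_sym a).
  by case: eqP.
have [[c [iD D2]]|Nsmall] := pselect (exists c, i \in D c /\ #|D c| <= 2).
  have [a' Da'] : exists a' : option X, D c :\ i = [set j | a' == Some j].
    have [->|[a' a'D]] := set_0Vmem (D c :\ i).
      by exists None; apply/setP => j; rewrite !inE.
    exists (Some a'); apply/eqP; rewrite eq_sym eqEcard; apply/andP; split.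
      by apply/subsetP=> j; rewrite inE => /eqP[<-].
    have -> : #|[set j | Some a' == Some j]| = 1.
      by rewrite -(cards1 a'); apply: eq_card => j; rewrite !inE eq_sym.
    by rewrite (cardsD1 i) iD in D2.
  exists (fun=> a'); apply: (@catch_captured _ _ c); apply/setP=> j.
  move/setP/(_ j): Da'; rewrite !inE => <-.
  have [->|jNi] := eqVneq j i; first by rewrite eqxx iD.
  have -> : (Some i == Some j) = false by rewrite eq_sym; apply/negbTE.
  by rewrite /= addbb.
have big c : i \in D c -> 2 < #|D c|.
  by move=> iD; rewrite ltnNge; apply/negP=> D2; apply: Nsmall; exists c.
have iDc1 : i \notin D c1 by apply/negP => /big; rewrite (eqP c1s).
exists (fun c => if (c == c1) || (i \in D c) then None else Some i).
set D' := fun c => _.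
have D'c1 : D' c1 = i |: D c1.
  apply/setP=> j; rewrite /D' eqxx !inE /=.
  have [->|jNi] := eqVneq j i; first by rewrite eqxx (negbTE iDc1).
  by have -> : (Some i == Some j) = false by rewrite eq_sym; apply/negbTE.
have D'E c : c != c1 -> D' c = D c :\ i.
  move=> /negbTE cc1; apply/setP=> j; rewrite /D' cc1 /= !inE.
  have [->|jNi] := eqVneq j i.
    by case: ifP => iD; rewrite ?eqxx ?iD.
  have iNj : (Some i == Some j) = false by rewrite eq_sym; apply/negbTE.
  by case: ifP; rewrite ?iNj.
clearbody D'; apply: IHs => [j|].
  have [->|jNi] := eqVneq j i.
    rewrite -(cards1 c1); apply: subset_leq_card; apply/subsetP=> c.
    rewrite finset.in_set1 finset.in_set.
    by apply: contraLR => /D'E ->; rewrite !inE eqxx.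
  apply: leq_trans (le1 j); apply: subset_leq_card; apply/subsetP=> c; rewrite !finset.in_set.
  have [->|/D'E ->] := eqVneq c c1; first by rewrite D'c1 !inE (negbTE jNi).
  by rewrite !inE => /andP[].
rewrite -ltnS; apply: leq_trans les; apply: proper_card; apply/properP; split.
  apply/subsetP=> c; rewrite !finset.in_set; have [->//|/D'E ->] := eqVneq c c1.
  by have := big c; have := cardsD1 i (D c); case: (i \in D c) => /= -> ; lia.
by exists c1; rewrite !inE ?c1s // D'c1 cardsU1 iDc1 (eqP c1s).
Qed.

Lemma catch_from_anywhere D : #|X| < 2 * #|I| ->
  catch (\sum_(1 <= h < #|I|) (#|X| %/ h).+1 + #|I|) D.
Proof.
move=> ltXI; have: 0 < #|I| by lia.
case cI: #|I| => [//|H] _; apply: catch_level => [D1 D1le|j].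
  by apply: catch_disjoint => //; rewrite -cI; exact: max_card.
by rewrite -cI; exact: max_card.
Qed.

End DifferenceGame.

(** * From difference sets to strategies on the hypercube *)

Section Cube.
Import fintype finset.
Local Open Scope nat_scope.
Local Open Scope set_scope.
Variables (n k : nat).
Implicit Types (v r : {ffun 'I_n -> bool}) (p : 'I_k -> {ffun 'I_n -> bool}).

Definition flip (x : option 'I_n) v : {ffun 'I_n -> bool} :=
  [ffun i => (x == Some i) (+) v i].

Lemma adjP r v : reflect (exists x, v = flip x r) (cube_adj r v).
Proof.
apply: (iffP idP) => [/card_le1_eqP adj1|[x ->]].
  have [i iP|none] := pickP (fun i => r i != v i).
    exists (Some i); apply/ffunP=> j; rewrite ffunE.
    have [[<-]|ij] := eqVneq (Some i) (Some j).
      by move: iP; case: (r i); case: (v i).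
    apply/eqP; apply: contraNT ij; rewrite /= eq_sym => jP.
    by rewrite (adj1 i j).
  exists None; apply/ffunP=> j; rewrite ffunE /=.
  by have /negbFE/eqP -> := none j.
rewrite /cube_adj; apply/card_le1_eqP => i j; rewrite !inE !ffunE.
have [->|_] := eqVneq x (Some i); last by rewrite eqxx.
by have [[->]|_] := eqVneq (Some i) (Some j); last by rewrite eqxx.
Qed.

Definition offset p r (c : 'I_k) : {set 'I_n} := [set i | p c i != r i].

Lemma toggle_offset p r x c : toggle x (offset p r c) = offset p (flip x r) c.
Proof.
by apply/setP=> i; rewrite !inE ffunE; case: (x == _); case: (p c i); case: (r i).
Qed.

Lemma offset_flip (f : 'I_k -> option 'I_n) p r :
  offset (fun c => flip (f c) (p c)) r = fun c => toggle (f c) (offset p r c).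
Proof.
apply/funext => c; apply/setP=> i; rewrite !inE ffunE.
by case: (f c == _); case: (p c i); case: (r i).
Qed.

Lemma offset_eq0 p r c : (offset p r c == finset.set0) = (p c == r).
Proof.
apply/eqP/eqP => [/setP d0|pr].
  by apply/ffunP=> i; have := d0 i; rewrite !inE => /negbFE/eqP.
by apply/setP=> i; rewrite !inE pr eqxx.
Qed.

(** Since [legal] ranges over all histories, the cops stand still when no move leads to
    [catch t]. *)
Definition reply t p r : 'I_k -> {ffun 'I_n -> bool} :=
  match pselect (exists p', (forall c, cube_adj (p c) (p' c)) /\
                            catch t (offset p' r)) with
  | left ex => projT1 (cid ex)
  | right _ => p
  end.

Lemma reply_adj t p r c : cube_adj (p c) (reply t p r c).
Proof.
rewrite /reply; case: pselect => [ex|_]; last exact: cube_adj_refl.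
by case: cid => p' [/= adjp' _].
Qed.

Lemma catch_reply t p p' r : (forall c, cube_adj (p c) (p' c)) ->
  catch t (offset p' r) -> catch t (offset (reply t p r) r).
Proof.
move=> adjp catchp; rewrite /reply; case: pselect => [ex|[]]; last by exists p'.
by case: cid => p'' [/= _].
Qed.

Definition reply_step (st : nat * ('I_k -> {ffun 'I_n -> bool})) r :=
  (st.1.-1, reply st.1.-1 st.2 r).

(** The extra round is the first: [catch T] describes positions after a move of the cops, and they
    can reach it by standing still once [r 0] is known. *)
Lemma catch_cops_win_within T p : (forall r, catch T (offset p r)) ->
  cops_win_within (hypercube n) k T.+1.
Proof.
move=> catchp.
pose st (h : seq {ffun 'I_n -> bool}) := foldl reply_step (T.+1, p) h.
have stS h r : st (rcons h r) = reply_step (st h) r by exact: foldl_rcons.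
have st1 h : (st h).1 = T.+1 - size h.
  elim/last_ind: h => [|h r IHh]; first by rewrite subn0.
  by rewrite stS size_rcons /= IHh; lia.
pose sigma : strategy (hypercube n) k := fun h => (st h).2.
exists sigma; split.
  by move=> h r c; rewrite /sigma stS; exact: reply_adj.
move=> r walk.
(* The history [mkseq r s.+1] ends with [r s], so the offsets are those in the middle of round
   [s.+1], before the robber moves. *)
have inv s : s <= T ->
    (exists s', s' <= s /\ captured_in sigma r s') \/
    catch (T - s) (offset (st (mkseq r s.+1)).2 (r s)).
  elim: s => [_|s IHs ltsT].
    right; rewrite subn0 /st /=; apply: (@catch_reply _ _ p) => // c.
    exact: cube_adj_refl.
  have [[s' [s's cap]]|] := IHs (ltnW ltsT).
    by left; exists s'; split=> //; exact: leqW.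
  have -> : T - s = (T - s.+1).+1 by lia.
  case=> [[c /eqP]|next].
    rewrite offset_eq0 => /eqP pc; left; exists s.+1; split=> //.
    by exists c; right.
  right; have /adjP[x rs] := walk s.
  have [f catchf] := next x.
  have -> : (st (mkseq r s.+2)).2 =
      reply (T - s.+1) (st (mkseq r s.+1)).2 (r s.+1).
    by rewrite [mkseq r s.+2]mkseqS stS /reply_step st1 size_mkseq subSS subnS.
  apply: (@catch_reply _ _ (fun c => flip (f c) ((st (mkseq r s.+1)).2 c))).
    by move=> c; apply/adjP; exists (f c).
  rewrite offset_flip rs.
  by under [X in catch _ X]funext do rewrite -toggle_offset.
have [[s [sT cap]]|] := inv T (leqnn T); first by exists s; split=> //; exact: leqW.
rewrite subnn => -[[c /eqP]|//]; rewrite offset_eq0 => /eqP pc.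
by exists T.+1; split=> //; exists c; right.
Qed.

End Cube.

(** * Escaping from too few cops *)

Section Evasion.
Import fintype finset.
Local Open Scope nat_scope.
Local Open Scope set_scope.

(** For a singleton the possible [x] are its element and [None], for a pair its two elements; larger
    sets admit none. *)
Lemma card_toggle_le1 (X : finType) (A : {set X}) : (0 < #|A|)%N ->
  #|[set x | #|toggle x A| <= 1]| <= 2.
Proof.
rewrite card_gt0 => /finset.set0Pn[a aA].
pose y := if [pick b in A :\ a] is Some b then Some b else None.
apply: (@leq_trans #|[set Some a; y]|); last by rewrite cards2; case: eqP.
apply: subset_leq_card; apply/subsetP=> x; rewrite finset.in_set.
apply: contraLR; rewrite finset.in_set2 negb_or => /andP[xa xy]; rewrite -ltnNge.
have aT : a \in toggle x A by rewrite inE aA (negbTE xa).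
suff [b ba bT] : exists2 b, b != a & b \in toggle x A.
  by apply/card_gt1P; exists b, a.
move: xy; rewrite /y; case: pickP => [b|none].
  rewrite finset.in_setD1 => /andP[ba bA] xb; exists b => //.
  by rewrite inE bA (negbTE xb).
case: x xa {aT} => [b|//] ba _; exists b; first by [].
rewrite inE eqxx; have := none b; rewrite finset.in_setD1.
by rewrite (_ : b != a) //= => ->.
Qed.

(** Each cop rules out at most two of the [#|X| + 1] moves. *)
Lemma dodge (I X : finType) (D : I -> {set X}) : 2 * #|I| <= #|X| ->
  (forall c, 0 < #|D c|) -> exists x, forall c, 1 < #|toggle x (D c)|.
Proof.
move=> leIX D0.
have [x xP|none] := pickP (fun x => [forall c, 1 < #|toggle x (D c)|]).
  by exists x; apply/forallP.
suff : #|{: option X}| <= 2 * #|I| by rewrite card_option; lia.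
rewrite -sum1_card.
apply: (@leq_trans
  (\sum_(x : option X) \sum_(c | #|toggle x (D c)| <= 1) 1)).
  apply: leq_sum => x _; move/negbT: (none x); rewrite negb_forall => /existsP[c].
  by rewrite -leqNgt => xc; rewrite (bigD1 c).
rewrite (exchange_big_dep predT) //= mulnC -sum_nat_const; apply: leq_sum => c _.
by rewrite sum1_card -(cardsE (fun x => #|toggle x (D c)| <= 1)); exact: card_toggle_le1.
Qed.

(** If [2 * k <= n], the robber can always dodge to a vertex outside the closed neighbourhoods of
    all cops, and so survives their next move. *)
Lemma cops_win_lower n k : cops_win (hypercube n) k -> n < 2 * k.
Proof.
case=> sigma [legal wins]; rewrite ltnNge; apply/negP => le2k.
pose V : finType := {ffun 'I_n -> bool}.
have [v0 v0P] : exists v0 : V, forall c, sigma [::] c != v0.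
  have [v vP|none] := pickP (fun v : V => [forall c, sigma [::] c != v]).
    by exists v; apply/forallP.
  have : #|V| <= #|'I_k|.
    apply: leq_trans (leq_imset_card (sigma [::] : _ -> V) _).
    apply: subset_leq_card; apply/subsetP=> v _; apply/imsetP.
    move/negbT: (none v); rewrite negb_forall => /existsP[c]; rewrite negbK => /eqP <-.
    by exists c.
  rewrite card_ffun card_bool !card_ord => le2n.
  by have := ltn_expl n (isT : 1 < 2); lia.
have /choice[move moveP] : forall st : seq V * V, exists v,
    (forall c, sigma st.1 c != st.2) ->
    cube_adj st.2 v /\ forall c, ~~ cube_adj (sigma st.1 c) v.
  case=> h v /=.
  have [free|] := pselect (forall c, sigma h c != v); last by exists v.
  have [||x xP] := @dodge 'I_k 'I_n (offset (sigma h) v).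
  - by rewrite !card_ord.
  - by move=> c; rewrite card_gt0 offset_eq0.
  exists (flip x v) => _; split; first by apply/adjP; exists x.
  move=> c; have := xP c; rewrite toggle_offset /offset cardsE ltnNge.
  by apply: contra.
pose step st := (rcons st.1 (move st), move st).
pose st t := iter t step ([::], v0).
(* The position [v0] precedes the game: [r 0] is already a dodge from it, hence out of reach of
   every cop. *)
pose r t := (st t.+1).2.
have hist t : (st t).1 = mkseq r t.
  by elim: t => [|t IHt] //; rewrite [mkseq r t.+1]mkseqS -IHt.
have free t c : sigma (st t).1 c != (st t).2.
  elim: t c => [|t IHt] c; first exact: v0P.
  have [_ /(_ c)] := moveP (st t) IHt; apply: contra => /eqP /= <-.
  by have := legal (st t).1 (move (st t)) c.
have [|t [c]] := wins r; first by move=> t; exact: (moveP _ (free t.+1)).1.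
rewrite -hist => -[cap|[t0 cap]].
  have := (moveP _ (free t)).2 c; rewrite cap.
  by rewrite (cube_adj_refl (r t)).
by have := free t c; rewrite cap /r prednK ?eqxx.
Qed.

End Evasion.

(** * Playing in all copies of a subcube at once *)

Section Lift.
Import fintype finset.
Local Open Scope nat_scope.
Local Open Scope set_scope.
Variables (m d : nat).

Definition glue (u : {ffun 'I_m -> bool}) (y : {ffun 'I_d -> bool}) :
    {ffun 'I_(m + d) -> bool} :=
  [ffun i => match fintype.split i with inl a => u a | inr b => y b end].

Definition head_part (v : {ffun 'I_(m + d) -> bool}) : {ffun 'I_m -> bool} :=
  [ffun a => v (lshift d a)].

Definition tail_part (v : {ffun 'I_(m + d) -> bool}) : {ffun 'I_d -> bool} :=
  [ffun b => v (rshift m b)].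

Lemma glueK v : glue (head_part v) (tail_part v) = v.
Proof.
apply/ffunP=> i; rewrite ffunE.
by case: fintype.splitP => j ij; rewrite ffunE; congr (v _); exact: val_inj.
Qed.

Lemma adj_glue u u' y : cube_adj u u' -> cube_adj (glue u y) (glue u' y).
Proof.
case/adjP=> x ->; apply/adjP; exists (omap (@lshift m d) x); apply/ffunP=> i.
rewrite !ffunE; case: fintype.splitP => j ij; rewrite ?ffunE.
  congr (_ (+) _); have -> : i = lshift d j by exact: val_inj.
  by case: x => //= a; apply/eqP/eqP => [[->]//|[/lshift_inj ->]].
have -> : i = rshift m j by exact: val_inj.
case: x => [a|] //=; rewrite -[_ == Some _]/(lshift d a == rshift m j).
by rewrite eq_lrshift.
Qed.

Lemma adj_head v v' : cube_adj v v' -> cube_adj (head_part v) (head_part v').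
Proof.
move=> /card_le1_eqP adjv; apply/card_le1_eqP => i j; rewrite !inE !ffunE => iv jv.
by apply/(@lshift_inj m d)/adjv; rewrite inE.
Qed.

(* One team of cops per vertex of the last [d] coordinates, all playing the same
   game against the projection of the robber: the team lying in the robber's
   own copy of [hypercube m] captures him. *)
Lemma cops_win_within_lift k0 k t : 2 ^ d * k0.+1 <= k ->
  cops_win_within (hypercube m) k0.+1 t ->
  cops_win_within (hypercube (m + d)) k t.
Proof.
move=> lek [sigma [legal wins]].
pose T : finType := ({ffun 'I_d -> bool} * 'I_k0.+1)%type.
have cardT : #|T| <= k by rewrite card_prod card_ffun card_bool !card_ord.
(* Surplus cops all take the default job. *)
pose job (i : 'I_k) : T := nth ([ffun=> false], ord0) (enum T) i.
have job_onto y c : exists i, job i = (y, c).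
  exists (widen_ord cardT (enum_rank (y, c))).
  by rewrite /job /= nth_enum_rank.
exists (fun h i => glue (sigma (map head_part h) (job i).2) (job i).1); split.
  by move=> h r i; rewrite map_rcons; apply: adj_glue; exact: legal.
move=> r walk; have [|s [st [c cap]]] := wins (head_part \o r).
  by move=> s; apply: adj_head; exact: walk.
exists s; split=> //; rewrite /captured_in.
have map_mk : map head_part (mkseq r s) = mkseq (head_part \o r) s.
  by rewrite /mkseq -map_comp.
case: cap => [cap|[s0 cap]].
  have [i iP] := job_onto (tail_part (r s)) c; exists i; left.
  by rewrite map_mk iP /= cap /= glueK.
have [i iP] := job_onto (tail_part (r s.-1)) c; exists i; right; split=> //.
by rewrite map_mk iP /= cap /= glueK.
Qed.

End Lift.

(** * The resulting capture time *)

Section CubeTime.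
Local Open Scope nat_scope.

(** The bound of [catch_from_anywhere] for [m] coordinates and [m./2.+1] cops, the least number
    exceeding [m / 2], plus the opening round. *)
Definition cube_time (m : nat) : nat :=
  (\sum_(1 <= h < m./2.+1) (m %/ h).+1 + m./2.+1).+1.

Lemma cops_win_within_cube_time m d k : 2 ^ d * m./2.+1 <= k ->
  cops_win_within (hypercube (m + d)) k (cube_time m).
Proof.
move=> lek; apply: cops_win_within_lift lek _.
apply: (@catch_cops_win_within _ _ _ (fun=> [ffun=> false])) => r.
have := @catch_from_anywhere _ _ (@offset m m./2.+1 (fun=> [ffun=> false]) r).
by rewrite !card_ord; apply; lia.
Qed.

End CubeTime.

(** * Analytic estimates *)

Section Estimates.
Variable R : realType.
Implicit Types x y : R.

Lemma ln_le_subr1 x : 0 < x -> ln x <= x - 1.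
Proof. by move=> x0; have := @le_ln1Dx R (x - 1); rewrite [1 + _]addrC subrK; apply; lra. Qed.

Lemma ln2_le1 : ln (2 : R) <= 1.
Proof. by have := @ln_le_subr1 2; lra. Qed.

Lemma ln2_ge_half : 1 / 2 <= ln (2 : R).
Proof.
have := @ln_le_subr1 (2^-1); rewrite lnV ?posrE// => /(_ _); lra.
Qed.

(** This is [ln s <= s - 1] at the square root [s] of [x]. *)
Lemma sqr_ln_le x : 1 <= x -> ln x ^+ 2 <= 4 * x.
Proof.
move=> x1; have x0 : 0 < x by lra.
have s0 : 0 < Num.sqrt x by rewrite sqrtr_gt0.
have -> : ln x = ln (Num.sqrt x) *+ 2 by rewrite -lnXn // sqr_sqrtr // ltW.
have := ln_le_subr1 s0; have : 0 <= ln (Num.sqrt x).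
  by apply: ln_ge0; rewrite -sqrtr1 ler_sqrt //; lra.
have := sqr_sqrtr (ltW x0); nra.
Qed.

Lemma harmonic_le_ln n :
  \sum_(1 <= h < n.+2) (h%:R^-1 : R) <= 1 + ln (n.+1%:R).
Proof.
elim: n => [|n IHn]; first by rewrite big_nat1 invr1 ln1 addr0.
rewrite big_nat_recr //=.
have n0 : 0 < n.+1%:R :> R by rewrite ltr0n.
have n1 : 0 < n.+2%:R :> R by rewrite ltr0n.
have := @ln_le_subr1 (n.+1%:R / n.+2%:R) (divr_gt0 n0 n1).
rewrite ln_div ?posrE //.
have -> : n.+1%:R / n.+2%:R - 1 = - n.+2%:R^-1 :> R.
  by rewrite -[n.+2%:R]natr1; field; rewrite gt_eqF //; move: n1; rewrite -natr1; lra.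
move: IHn; move: (ln _) (ln _) (_^-1) (\sum_(1 <= h < n.+2) _) => a b c d; lra.
Qed.

Lemma cube_time_le m : (0 < m)%N ->
  (cube_time m)%:R <= m%:R * ln m%:R + 3 * m%:R :> R.
Proof.
move=> m0; have m1 : 1 <= m%:R :> R by rewrite ler1n.
have lnm : 0 <= ln (m%:R : R) by exact: ln_ge0.
pose h := m./2; have hm : (h.*2 <= m)%N by rewrite /h; lia.
have sum_le : \sum_(1 <= i < h.+1) (i%:R^-1 : R) <= 1 + ln m%:R.
  case: h hm => [|h] hm; first by rewrite big_geq //; lra.
  apply: le_trans (harmonic_le_ln h) _.
  by rewrite lerD2l ler_ln ?posrE ?ltr0n // ler_nat; lia.
have div_le : (\sum_(1 <= i < h.+1) (m %/ i).+1)%:R <=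
    m%:R * (\sum_(1 <= i < h.+1) (i%:R^-1 : R)) + h%:R.
  have -> : h%:R = \sum_(1 <= i < h.+1) 1 :> R.
    by rewrite big_const_nat iter_addr_0 subn1.
  rewrite natr_sum mulr_sumr -big_split /= big_nat [leRHS]big_nat.
  apply: ler_sum => i /andP[i0 _]; rewrite -natr1 lerD2r ler_pdivlMr ?ltr0n //.
  by rewrite -natrM ler_nat leq_divM.
rewrite /cube_time -/h -natr1 natrD -[h.+1%:R]natr1.
have hm' : 2 * h%:R <= m%:R :> R by rewrite -natrM ler_nat mul2n.
(* The additive constant 2 left over fits into the third [m] only when [m >= 2]. *)
have [m2|] := leqP 2 m.
  have : 2 <= m%:R :> R by rewrite ler_nat.
  by nra.
rewrite ltnS => le1; have h0 : h = 0%N by lia.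
by rewrite h0 big_geq //; nra.
Qed.

(** The value [m = n] qualifies because [n < 2 * k]; failure just below the least [m] is what later
    bounds [m] from above. *)
Lemma choose_dim n k : (n < 2 * k)%N -> exists m, [/\ (m <= n)%N,
  (2 ^ (n - m) * m./2.+1 <= k)%N &
  forall m', m = m'.+1 -> (k < 2 ^ (n - m') * m'./2.+1)%N].
Proof.
move=> ltnk; have ex : exists m, (m <= n)%N && (2 ^ (n - m) * m./2.+1 <= k)%N.
  by exists n; rewrite leqnn subnn mul1n /=; lia.
exists (ex_minn ex); case: ex_minnP => m /andP[mn mk] minm; split=> // m' mE.
rewrite ltnNge; apply/negP=> le; have := minm m'; rewrite le andbT mE => /(_ _); lia.
Qed.

Lemma log2_ratio n (k : R) : 0 < k ->
  log2 (2 ^+ n / k) * ln 2 = n%:R * ln 2 - ln k.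
Proof.
move=> k0; rewrite /log2 divfK; last by rewrite gt_eqF //; have := ln2_ge_half; lra.
by rewrite ln_div ?posrE ?exprn_gt0 // lnXn // mulr_natl.
Qed.

(** An explicit bound, uniform in [n] and [k], from which both asymptotic claims follow. *)
Lemma cops_win_within_log n k : let y : R := log2 (2 ^+ n / k%:R) in
  (n < 2 * k)%N -> 4 <= y ->
  exists T, cops_win_within (hypercube n) k T /\ T%:R <= y * (ln y + 35).
Proof.
move=> y ltnk y4; have k0 : 0 < k%:R :> R by rewrite ltr0n; lia.
have [m [mn mk minm]] := choose_dim ltnk.
exists (cube_time m); split.
  by have := cops_win_within_cube_time mk; rewrite subnKC.
have l2 := ln2_ge_half; have l2' := ln2_le1.
have yE : y * ln 2 = n%:R * ln 2 - ln k%:R by exact: log2_ratio.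
(* For [m = 0] one would have [2 ^ n <= k], contradicting [y >= 4]. *)
case: m mn mk minm => [_ mk _|m mn _ /(_ m erefl) minm].
  have : n%:R * ln 2 <= ln (k%:R : R).
    rewrite mulr_natl -lnXn // ler_ln ?posrE ?exprn_gt0 // -natrX ler_nat.
    by move: mk; rewrite subn0 muln1.
  by nra.
set M : R := m.+1%:R.
have M1 : 1 <= M by rewrite ler1n.
have M0 : 0 < M by rewrite ltr0n.
have p2 j : 0 < 2 ^+ j :> R by exact: exprn_gt0.
have lM0 : 0 <= ln M by exact: ln_ge0.
have lnM_le : m%:R * ln 2 <= y * ln 2 + ln M.
  have : ln (k%:R * 2 ^+ m) <= ln (2 ^+ n * M).
    rewrite ler_ln ?posrE ?mulr_gt0 //.
    rewrite /M -!natrX -!natrM ler_nat -(subnK (ltnW mn)) expnD.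
    rewrite mulnAC leq_mul2r; apply/orP; right; apply: leq_trans (ltnW minm) _.
    by rewrite leq_mul2l; apply/orP; right; lia.
  rewrite !lnM ?posrE //.
  by rewrite !lnXn // -[_ *+ m]mulr_natl -[_ *+ n]mulr_natl yE; lra.
have ME : M = m%:R + 1 by rewrite natr1.
(* Bootstrapping: a linear bound on [ln M] first gives [M <= 4 * y], hence [ln M <= ln y + 2], which
   is fed back into this inequality. *)
have M_le : M <= y + 1 + 2 * ln M by nra.
have ln4 : ln (4 : R) <= 2.
  have -> : (4 : R) = 2 ^+ 2 by rewrite -natrX.
  by rewrite lnXn //; lra.
have lnM_lin : ln M <= M / 4 + 1.
  have : ln (M / 4) <= M / 4 - 1 by apply: ln_le_subr1; lra.
  by rewrite ln_div ?posrE //; lra.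
have lnM_ln : ln M <= ln y + 2.
  apply: (@le_trans _ _ (ln (4 * y))).
    by rewrite ler_ln ?posrE //; lra.
  by rewrite lnM ?posrE //; lra.
have ly0 : 0 <= ln y by apply: ln_ge0; lra.
have ly : ln y <= y - 1 by apply: ln_le_subr1; lra.
have ly2 : ln y ^+ 2 <= 4 * y by apply: sqr_ln_le; lra.
apply: le_trans (cube_time_le _) _ => //; rewrite -/M.
have : M * (ln M + 3) <= (y + 5 + 2 * ln y) * (ln y + 5).
  by apply: ler_pM; lra.
by nra.
Qed.

Lemma capt_le (G : Defs.rgraph) k T (z : R) :
  cops_win_within G k T -> T%:R <= z -> (capt G k R <= z%:E)%E.
Proof.
move=> win le; apply: (@le_trans _ _ (T%:R%:E)); last by rewrite lee_fin.
by apply: ereal_inf_lbound; exists T.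
Qed.

Lemma cvg_div_pinfty (c : R) (u : nat -> R) :
  u n @[n --> \oo] --> +oo -> c / u n @[n --> \oo] --> (0 : R).
Proof.
move=> uy; rewrite -[0](mulr0 c); apply: cvgMr; apply/gtr0_cvgV0 => //.
  by move/cvgryPgt : uy; apply.
Qed.

End Estimates.

(** * The asymptotic statements *)

Unset Implicit Arguments.

Theorem theorem3p2 (R : realType) :
  (forall (omega : nat -> R) (k : nat -> nat),
     omega n @[n --> \oo] --> +oo ->
     (\forall n \near \oo,
        (cop_number (hypercube n) <= k n)%N /\
        (k n)%:R <= 2 ^+ n / omega n) ->
     exists eps : nat -> R,
       eps n @[n --> \oo] --> (0 : R) /\
       \forall n \near \oo,
         (capt (hypercube n) (k n) R <=
          ((1 + eps n) * log2 (2 ^+ n / (k n)%:R)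
             * ln (ln (2 ^+ n / (k n)%:R)))%:E)%E)
  /\
  (forall (b : R) (k : nat -> nat),
     1 < b -> b < 2 ->
     (\forall n \near \oo, `|(k n)%:R - b ^+ n| < 1) ->
     exists eps : nat -> R,
       eps n @[n --> \oo] --> (0 : R) /\
       \forall n \near \oo,
         (capt (hypercube n) (k n) R <=
          ((1 + eps n) * (1 - log2 b) * n%:R * ln (n%:R))%:E)%E).
Proof.
have l2 := ln2_ge_half R; have l2' := ln2_le1 R.
have l20 : ln 2 != 0 :> R by rewrite gt_eqF //; lra.
split=> [omega k omegay kP|b k b1 b2 kP].
  pose q n : R := 2 ^+ n / (k n)%:R.
  have ltnk n : (cop_number (hypercube n) <= k n)%N -> (n < 2 * k n)%N.
    rewrite /cop_number; case: ex_minnP => c /asboolP/cops_win_lower lt _ le.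
    by apply: leq_trans lt _; rewrite leq_mul2l.
  have q_large (A : R) : \forall n \near \oo, expR A <= q n.
    near=> n.
    have [cop_le k_le] : (cop_number (hypercube n) <= k n)%N /\
      (k n)%:R <= 2 ^+ n / omega n by near: n.
    have omega_ge : expR A <= omega n by near: n; move/cvgryPge : omegay; apply.
    have omega0 : 0 < omega n by apply: lt_le_trans omega_ge; exact: expR_gt0.
    have k0 : 0 < (k n)%:R :> R by rewrite ltr0n; have := ltnk _ cop_le; lia.
    apply: le_trans omega_ge _; rewrite ler_pdivlMr // mulrC.
    by rewrite -ler_pdivlMr.
  have ln_large (A x : R) : expR A <= x -> A <= ln x.
    move=> Ax; rewrite -[A]expRK ler_ln ?posrE ?expR_gt0 //.
    exact: lt_le_trans (expR_gt0 A) Ax.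
  have lnlnq_y : ln (ln (q n)) @[n --> \oo] --> +oo.
    apply/cvgryPge => A; near=> n; apply/ln_large/ln_large.
    by near: n; exact: q_large.
  (* The 36 is 35 from [cops_win_within_log] plus 1 for [ln y <= L + 1], the cost of passing from
     base 2 to natural logarithms. *)
  exists (fun n => 36 / ln (ln (q n))); split; first exact: cvg_div_pinfty.
  near=> n; rewrite -/(q n).
  have [cop_le _] : (cop_number (hypercube n) <= k n)%N /\
    (k n)%:R <= 2 ^+ n / omega n by near: n.
  have lnq4 : 4 <= ln (q n) by apply: ln_large; near: n; exact: q_large.
  have : 1 <= ln (ln (q n)) by near: n; move/cvgryPge : lnlnq_y; apply.
  set L := ln (ln (q n)) => L1.
  set y := log2 (q n).
  have yE : y * ln 2 = ln (q n) by rewrite /y /log2 divfK.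
  have y4 : 4 <= y by nra.
  have lny : ln y <= L + 1.
    rewrite /L -yE lnM ?posrE; [|lra|lra].
    suff : - 1 <= ln (ln 2 : R) by lra.
    apply: (@le_trans _ _ (ln (2^-1))); first by rewrite lnV ?posrE //; lra.
    by rewrite ler_ln ?posrE //; lra.
  have [T [win Tle]] := cops_win_within_log (ltnk _ cop_le) y4.
  apply: (capt_le win); apply: (le_trans Tle).
  have -> : (1 + 36 / L) * y * L = y * (L + 36) by field; rewrite gt_eqF //; lra.
  by rewrite -/(q n) -/y ler_pM2l; lra.
have lnb : 0 < ln b by exact: ln_gt0.
pose beta := 1 - log2 b.
have betaE : beta * ln 2 = ln 2 - ln b by rewrite /beta /log2 mulrBl divfK // mul1r.
have beta0 : 0 < beta.
  have : ln b < ln 2 by rewrite ltr_ln ?posrE //; lra.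
  by nra.
have beta1 : beta <= 1.
  by nra.
have lnn_y : ln (n%:R : R) @[n --> \oo] --> +oo.
  apply/cvgryPge => A; near=> n.
  have An : expR A <= n%:R by near: n; exact: nbhs_infty_ger.
  rewrite -[A]expRK ler_ln ?posrE ?expR_gt0 //.
  exact: lt_le_trans (expR_gt0 A) An.
(* Expanding [(beta * n + 1) * (ln n + 36)] leaves the error [36 * beta * n + ln n + 36], and
   [ln n + 36 <= 37 * n]. *)
pose C := 36 + 37 / beta.
exists (fun n => C / ln n%:R); split; first exact: cvg_div_pinfty.
near=> n.
have n1 : 1 <= n%:R :> R by near: n; exact: nbhs_infty_ger.
have nb5 : 5 / beta <= n%:R by near: n; exact: nbhs_infty_ger.
have nb2 : 2 / ln b ^+ 2 <= n%:R by near: n; exact: nbhs_infty_ger.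
have lnn1 : 1 <= ln (n%:R : R) by near: n; move/cvgryPge : lnn_y; apply.
have kb : `|(k n)%:R - b ^+ n| < 1 by near: n.
set B := b ^+ n in kb; have B0 : 0 < B by apply: exprn_gt0; lra.
have lnB : ln B = n%:R * ln b by rewrite lnXn ?mulr_natl //; lra.
(* The quadratic term of the exponential series beats [n]. This gives [n < 2 * k n] and places [k n]
   within a factor 2 of [B], so [y] is within 1 of [beta * n]. *)
have B_ge : 1 + n%:R <= B.
  have := @expR_ge1Dxn R (ln B) 1; rewrite lnK ?posrE // lnB => /(_ _).
  rewrite ler_pdivrMr in nb2; last by rewrite exprn_gt0.
  have -> : 2`!%:R = 2 :> R by [].
  have : 2 * n%:R <= (n%:R * ln b) ^+ 2 by nra.
  have : 0 <= n%:R * ln b by nra.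
  by move=> h1 h2 /(_ h1); lra.
move: kb; rewrite ltr_norml => /andP[kb kb'].
have ltnk : (n < 2 * k n)%N by rewrite -(ltr_nat R) natrM; lra.
have k0 : 0 < (k n)%:R :> R by lra.
pose y : R := log2 (2 ^+ n / (k n)%:R).
have yE : y * ln 2 = n%:R * ln 2 - ln (k n)%:R by exact: log2_ratio.
have lnk_ge : ln B - ln 2 <= ln (k n)%:R.
  by rewrite -ln_div ?posrE // ler_ln ?posrE ?divr_gt0 //; lra.
have lnk_le : ln (k n)%:R <= ln B + ln 2.
  by rewrite -lnM ?posrE // ler_ln ?posrE ?mulr_gt0 //; lra.
have y_le : y <= beta * n%:R + 1 by nra.
have y4 : 4 <= y.
  have : 5 <= beta * n%:R by rewrite mulrC -ler_pdivrMr.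
  by nra.
have [T [win Tle]] := cops_win_within_log ltnk y4.
apply: (capt_le win); apply: (le_trans Tle); rewrite -/y -/beta.
have lny : ln y <= ln n%:R + 1.
  apply: (@le_trans _ _ (ln (2 * n%:R))).
    by rewrite ler_ln ?posrE //; nra.
  by rewrite lnM ?posrE //; lra.
have lny0 : 0 <= ln y by apply: ln_ge0; lra.
apply: (@le_trans _ _ ((beta * n%:R + 1) * (ln n%:R + 36))).
  by apply: ler_pM; lra.
have lnn_le : ln (n%:R : R) <= n%:R - 1 by apply: ln_le_subr1; lra.
have -> : (1 + C / ln n%:R) * beta * n%:R * ln n%:R =
    beta * n%:R * ln n%:R + 36 * (beta * n%:R) + 37 * n%:R.
  by rewrite /C; field; rewrite !gt_eqF //; lra.
by nra.
Unshelve. all: by end_near.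
Qed.
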